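(* For all $n,j\ge 0$ and all $k\ge 2$, $$a^{(k)}_{n,231,j}=\sum_{j\ge i_{k-1}\ge\cdots\ge i_1\ge 0}\ \prod_{m=0}^{k-1}\binom{i_{m+2}+i_m}{2i_{m+1}},$$ where $i_0:=0$, $i_k:=j$, $i_{k+1}:=n$, and the sum is over integers $i_1,\dots,i_{k-1}$.
   Context: For $n\ge 1$ and $j,k\ge 0$, $a^{(k)}_{n,231,j}$ denotes the number of permutations $\sigma=\sigma_1\cdots\sigma_n$ of $[n]$ that avoid $231$ (no indices $a<b<c$ with $\sigma_c<\sigma_a<\sigma_b$), have exactly $j$ descents (indices $i\in[n-1]$ with $\sigma_i>\sigma_{i+1}$), and satisfy $\max\{i-\sigma_i: i\in[n]\}\le k$. For $n=0$ the convention is $a^{(k)}_{0,231,0}=1$ and $a^{(k)}_{0,231,j}=0$ for $j>0$. *)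

(* Defs.v *)
From mathcomp Require Import all_boot all_fingroup.

Set Implicit Arguments.
Unset Strict Implicit.
Unset Printing Implicit Defensive.

(* Permutations of [n] are elements of 'S_n, with positions and values both
   shifted to {0, ..., n-1}; order comparisons and the differences i - s i are
   unaffected by the shift. *)

Definition avoids231 (n : nat) (s : 'S_n) : bool :=
  [forall a : 'I_n, forall b : 'I_n, forall c : 'I_n,
     (a < b < c) ==> ~~ (s c < s a < s b)].

Definition des (n : nat) (s : 'S_n) : nat :=
  #|[set i : 'I_n | [exists i' : 'I_n, (i' == i.+1 :> nat) && (s i' < s i)]]|.

(* Truncated subtraction is harmless: the integers i - s i sum to 0, so for
   0 < n their maximum is nonnegative. For n = 0 the empty maximum is 0. *)
Definition maxdrop (n : nat) (s : 'S_n) : nat := \max_(i < n) (i - s i).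

(* For n = 0 this is 1 if j = 0, and 0 otherwise: 'S_0 has one element. *)
Definition a231 (k n j : nat) : nat :=
  #|[set s : 'S_n | [&& avoids231 s, des s == j & maxdrop s <= k]]|.

(* With t = (i_1, ..., i_(k-1)), entry m is i_m for 0 <= m <= k+1, where
   i_0 = 0, i_k = j and i_(k+1) = n. *)
Definition ext_index (k n j : nat) (t : (k.-1).-tuple 'I_j.+1) (m : nat) : nat :=
  nth 0 (0 :: [seq val i | i <- t] ++ [:: j; n]) m.

(* Main.v *)
Require Import Defs.
From mathcomp Require Import all_boot all_fingroup.
From mathcomp Require Import zify.

(* A 231-avoiding permutation of [n+1] is a word L n R with L < R, so removing
   the maximum gives, for the number B_K(n, j) of such permutations of [n] with
   j descents and all i - s i < K,
     B_(K+1)(n+1, j+1) = B_(K+1)(n, j+1)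
       + sum_(p < n) sum_(a <= j) B_(K+1)(p, a) B_K(n - p, j - a):
   the entries of R move one position further than their values, which lowers
   the drop bound by one. The nested binomial sums satisfy
     F_(K+1)(n, j) = sum_i C(n + i, 2 j) F_K(j, i),
   and the recurrence for (F_(K+1), F_K) implies the one for (F_(K+2), F_(K+1))
   through the convolution
     sum_p C(p + i, A) C(n - p + i', B) = C(n + i + i' + 1, A + B + 1),
   valid for i <= A and i' <= B. *)

Set Implicit Arguments.
Unset Strict Implicit.
Unset Printing Implicit Defensive.

(** * The nested binomial sums *)

(** Both sides count the subsets of {0, ..., N} with A + B + 1 elements; p is the element with
    exactly A smaller ones in the subset. *)
Lemma sum_conv_bin (N A B : nat) :
  \sum_(p < N.+1) 'C(p, A) * 'C(N - p, B) = 'C(N.+1, (A + B).+1).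
Proof.
elim: N A B => [|N IHN] A B.
  rewrite big_ord1 subn0 !bin0n binS bin0n.
  by case: A => [|A]; case: B => [|B] //=; rewrite bin0n.
case: B => [|B].
  rewrite addn0 big_ord_recr /= subnn bin0 muln1.
  have -> : \sum_(i < N.+1) 'C(i, A) * 'C(N.+1 - i, 0) = 'C(N.+1, A.+1).
    by rewrite -[A in RHS]addn0 -IHN; apply: eq_bigr => i _; rewrite !bin0.
  by rewrite [RHS]binS.
rewrite big_ord_recr /= subnn bin0n muln0 addn0 binS -IHN addnS -IHN -big_split.
apply: eq_bigr => i _ /=.
by rewrite subSn -1?ltnS // binS mulnDr.
Qed.

(** This is [sum_conv_bin] with N = n + i + i', its index shifted by i. The terms lost are zero:
    below i the first binomial vanishes because i <= A, and above n + i the second one because i' <=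
    B. *)
Lemma sum_conv_bin_shift (n i i' A B : nat) : i <= A -> i' <= B ->
  \sum_(p < n.+1) 'C(p + i, A) * 'C(n - p + i', B)
    = 'C((n + (i + i')).+1, (A + B).+1).
Proof.
move=> le_iA le_i'B; rewrite -sum_conv_bin.
rewrite -(big_mkord xpredT (fun p => 'C(p + i, A) * 'C(n - p + i', B))).
rewrite -(big_mkord xpredT (fun p => 'C(p, A) * 'C(n + (i + i') - p, B))).
rewrite [RHS](@big_cat_nat _ _ _ i) //=; last by lia.
rewrite [X in _ = X + _]big_nat_cond [X in _ = X + _]big1 ?add0n; last first.
  by move=> p /andP[/andP[_ lt_pi] _]; rewrite bin_small //; lia.
rewrite [RHS](@big_cat_nat _ _ _ (n.+1 + i)) /=; [|lia..].
rewrite [X in _ = _ + X]big_nat_cond [X in _ = _ + X]big1 ?addn0; last first.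
  by move=> p /andP[/andP[lt1 lt2] _]; rewrite [X in _ * X]bin_small ?muln0 //; lia.
rewrite -{2}[i]add0n big_addn addnK; apply: eq_big_nat => p lt_pn.
by congr (_ * 'C(_, _)); lia.
Qed.

(** Groups the rectangle by s = i + i'. The inner sum on the right also meets pairs outside the
    rectangle, where f or g vanishes. *)
Lemma sum_conv (f g h : nat -> nat) (a b : nat) :
    (forall i, a < i -> f i = 0) -> (forall i, b < i -> g i = 0) ->
  \sum_(i < a.+1) \sum_(i' < b.+1) f i * g i' * h (i + i')
    = \sum_(s < (a + b).+1) h s * \sum_(i < s.+1) f i * g (s - i).
Proof.
move=> f0 g0.
transitivity (\sum_(s < (a + b).+1) \sum_(i < (a + b).+1 | i < s.+1)
                 f i * g (s - i) * h s); last first.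
  apply: eq_bigr => s _; rewrite big_distrr /=.
  rewrite (big_ord_widen (a + b).+1 (fun i => h s * (f i * g (s - i)))) //.
  by apply: eq_bigr => i _; rewrite mulnC.
rewrite [RHS](exchange_big_dep xpredT) //=.
rewrite (big_ord_widen (a + b).+1 (fun i => \sum_(i' < b.+1) f i * g i' * h (i + i')));
  last by lia.
rewrite big_mkcond; apply: eq_bigr => i _; case: ltnP => [le_ia | lt_ai]; last first.
  by rewrite big1 // => s _; rewrite f0.
rewrite -(big_mkord (fun s => i < s.+1) (fun s => f i * g (s - i) * h s)).
rewrite [RHS](@big_cat_nat _ _ _ i) //=; last by lia.
rewrite [X in _ = X + _]big_nat_cond [X in _ = X + _]big_pred0 ?add0n; last by move=> s; lia.
rewrite [RHS](@big_cat_nat _ _ _ (b.+1 + i)) /=; [|lia..].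
rewrite [X in _ = _ + X]big_nat_cond [X in _ = _ + X]big1 ?addn0; last first.
  by move=> s /andP[/andP[lt1 lt2] _]; rewrite g0 ?muln0 //; lia.
rewrite -{3}[nat_of_ord i]add0n big_addn addnK big_mkord.
rewrite [RHS](eq_bigl xpredT); last by move=> s; lia.
by apply: eq_bigr => s _; rewrite addnK [s + i]addnC.
Qed.

(* For 0 < k, [binsum k.+1 n j] is the right-hand side of the theorem; starting
   one step below k = 0 makes [binsum_rec] hold from the bottom. *)
Fixpoint binsum (K n j : nat) : nat :=
  if K is K'.+1 then \sum_(i < j.+1) 'C(n + i, 2 * j) * binsum K' j i
  else (n == 0) && (j == 0).

Lemma binsum_0l (K j : nat) : binsum K 0 j = (j == 0).
Proof.
elim: K j => [|K IHK] [|j] //=; first by rewrite big_ord1 IHK.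
by apply: big1 => i _; rewrite bin_small //; have := ltn_ord i; lia.
Qed.

Lemma binsumS_0r (K n : nat) : binsum K.+1 n 0 = 1.
Proof. by rewrite /= big_ord1 bin0 binsum_0l. Qed.

Lemma binsum_small (K n j : nat) : n < j -> binsum K n j = 0.
Proof.
case: K j => [|K] [|j] // lt_nj /=; first by rewrite andbF.
by apply: big1 => i _; rewrite bin_small //; have := ltn_ord i; lia.
Qed.

Lemma binsumS (K n j : nat) :
  binsum K.+1 n j = \sum_(i < j.+1) 'C(n + i, 2 * j) * binsum K j i.
Proof. by []. Qed.

Lemma binsum_0 (n j : nat) : binsum 0 n j = (n == 0) && (j == 0).
Proof. by []. Qed.

Arguments binsum : simpl never.

Lemma binsum_1 (n j : nat) : binsum 1 n j = 'C(n, 2 * j) * (j == 0).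
Proof.
rewrite binsumS big_ord_recl big1 => [|i _]; last by rewrite binsum_0 andbF muln0.
by rewrite binsum_0 andbT !addn0.
Qed.

(** The term [binsum K.+1 n j] on the left balances p = n, a = j on the right, the only nonzero
    contribution of p = n. Including p = n makes the convolution complete, as [sum_conv_bin_shift]
    requires. *)
Lemma binsum_rec (K n j : nat) :
  binsum K.+1 n.+1 j.+1 + binsum K.+1 n j
    = binsum K.+1 n j.+1
      + \sum_(a < j.+1) \sum_(p < n.+1) binsum K.+1 p a * binsum K (n - p) (j - a).
Proof.
elim: K n j => [|K IHK] n j.
  (* Since [binsum 0] is supported at (0, 0), only a = j and p = n contribute. *)
  rewrite !binsum_1 !muln0 !add0n (bigD1 ord_max) //= [X in _ = _ + X]big1 ?addn0; last first.
    move=> a neq_aj; apply: big1 => p _.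
    rewrite binsum_0; suff -> : (j - a == 0) = false by rewrite andbF muln0.
    apply: contraNF neq_aj => le_ja; rewrite -val_eqE /=; have := ltn_ord a; lia.
  rewrite big_ord_recr big1 /=; last first.
    move=> p _; rewrite binsum_0; suff -> : (n - p == 0) = false by rewrite muln0.
    have := ltn_ord p; lia.
  by rewrite !subnn binsum_1 binsum_0 muln1.
(* Pascal's rule on C(n + 1 + i, 2 j + 2) splits off [binsum K.+2 n j.+1], which then cancels. *)
transitivity (binsum K.+2 n j.+1
  + (\sum_(i < j.+2) 'C(n + i, (2 * j).+1) * binsum K.+1 j.+1 i + binsum K.+2 n j)).
  rewrite addnA; congr (_ + _); rewrite !(binsumS K.+1) -big_split /=.
  apply: eq_bigr => i _; rewrite -mulnDl; congr (_ * _).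
  by rewrite mulnS addSn binS.
congr (_ + _).
(* Both factors are expanded and the sum over p is evaluated with A = 2 a and B = 2 (j - a), so that
   A + B + 1 = 2 j + 1 no longer depends on a. *)
transitivity (\sum_(a < j.+1) \sum_(i < a.+1) \sum_(i' < (j - a).+1)
   binsum K.+1 a i * binsum K (j - a) i' * 'C((n + (i + i')).+1, (2 * j).+1)); last first.
  apply: eq_bigr => a _.
  transitivity (\sum_(p < n.+1) \sum_(i < a.+1) \sum_(i' < (j - a).+1)
     (binsum K.+1 a i * binsum K (j - a) i')
       * ('C(p + i, 2 * a) * 'C(n - p + i', 2 * (j - a)))).
    rewrite [RHS]exchange_big; apply: eq_bigr => i _.
    rewrite [RHS]exchange_big; apply: eq_bigr => i' _.
    rewrite -big_distrr /= sum_conv_bin_shift.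
    - congr (_ * 'C(_, _)); have := ltn_ord a; lia.
    - have := ltn_ord i; lia.
    - have := ltn_ord i'; lia.
  apply: eq_bigr => p _; rewrite (binsumS K.+1) (binsumS K) big_distrl.
  apply: eq_bigr => i _.
  by rewrite big_distrr; apply: eq_bigr => i' _ /=; rewrite [RHS]mulnACA mulnC.
transitivity (\sum_(s < j.+1) 'C((n + s).+1, (2 * j).+1) *
   \sum_(a < j.+1) \sum_(i < s.+1) binsum K.+1 a i * binsum K (j - a) (s - i)); last first.
  under eq_bigr do rewrite big_distrr.
  rewrite exchange_big; apply: eq_bigr => a _ /=.
  rewrite (@sum_conv (binsum K.+1 a) (binsum K (j - a))
                     (fun i => 'C((n + i).+1, (2 * j).+1))) //=; [|exact: binsum_small..].
  by rewrite subnKC // -ltnS.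
(* The induction hypothesis one level down, with (j, s) in place of (n, j): here a is the size index
   and i the descent index. *)
have convE s :
    \sum_(a < j.+1) \sum_(i < s.+1) binsum K.+1 a i * binsum K (j - a) (s - i)
      + binsum K.+1 j s.+1
    = binsum K.+1 j.+1 s.+1 + binsum K.+1 j s.
  by rewrite IHK addnC exchange_big.
(* Adding the extra term of [convE] to both sides avoids subtraction. *)
apply: (@addIn (\sum_(s < j.+1) 'C((n + s).+1, (2 * j).+1) * binsum K.+1 j s.+1)).
rewrite -big_split /=.
under [RHS]eq_bigr do rewrite -mulnDr convE.
under [RHS]eq_bigr do rewrite mulnDr.
rewrite [RHS]big_split /= [RHS]addnC.
have split0 (f : nat -> nat) : \sum_(i < j.+2) 'C(n + i, (2 * j).+1) * f i
    = 'C(n, (2 * j).+1) * f 0 + \sum_(i < j.+1) 'C((n + i).+1, (2 * j).+1) * f i.+1.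
  rewrite big_ord_recl /= addn0; congr (_ + _).
  by apply: eq_bigr => i _; rewrite /bump leq0n add1n addnS.
(* The rows j + 1 and j of [binsum K.+1] trade places. This is possible because their entries at i =
   0 are both 1, and the other entries occur with the same binomials. *)
transitivity (\sum_(i < j.+2) 'C(n + i, (2 * j).+1) * binsum K.+1 j i + binsum K.+2 n j +
    \sum_(i < j.+1) 'C((n + i).+1, (2 * j).+1) * binsum K.+1 j.+1 i.+1).
  rewrite (split0 (binsum K.+1 j.+1)) (split0 (binsum K.+1 j)) !binsumS_0r -!addnA.
  congr (_ + _).
  by rewrite addnC -addnA [RHS]addnCA.
(* The entry i = j + 1 of row j is zero; Pascal's rule merges the rest with [binsum K.+2 n j]. *)
congr (_ + _); rewrite big_ord_recr /= [binsum K.+1 j j.+1]binsum_small // muln0 addn0.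
rewrite binsumS -big_split; apply: eq_bigr => i _.
by rewrite binS mulnDl.
Qed.

(** * The nested sum as a sum over weakly increasing tuples *)

Definition bin_prod (s : seq nat) : nat :=
  \prod_(m < size s - 2) 'C(nth 0 s m.+2 + nth 0 s m, 2 * nth 0 s m.+1).

Lemma bin_prod_rcons (s : seq nat) (x y z : nat) :
  bin_prod (rcons (rcons (rcons s x) y) z)
    = 'C(z + x, 2 * y) * bin_prod (rcons (rcons s x) y).
Proof.
rewrite /bin_prod !size_rcons !subSS !subn0 big_ord_recr /= mulnC; congr (_ * _).
  rewrite !nth_rcons !size_rcons; set N := size s.
  by rewrite !(ltnn, eqxx, leqnn, leqnSn, ltnS, (ltn_eqF (ltnSn _))).
apply: eq_bigr => m _; have lt_ms := ltn_ord m.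
by rewrite ![nth 0 (rcons _ z) _]nth_rcons !size_rcons !ltnS lt_ms
  (leqW (ltnW lt_ms)) (ltnW lt_ms).
Qed.

Lemma big_tuple_rcons (T : finType) (k : nat) (G : seq T -> nat) :
  \sum_(t : k.+1.-tuple T) G t = \sum_(x : T) \sum_(t : k.-tuple T) G (rcons t x).
Proof.
rewrite exchange_big pair_bigA /=.
rewrite (reindex (fun u : k.-tuple T * T => [tuple of rcons u.1 u.2])) //=.
apply: onW_bij; apply: inj_card_bij => [[t x] [t' x'] /= /(congr1 val) /=|].
  by move/rcons_inj => [/val_inj -> ->].
by rewrite card_prod !card_tuple expnSr.
Qed.

Lemma sorted_rcons2 (s : seq nat) (x y : nat) :
  sorted leq (rcons (rcons s x) y) = sorted leq (rcons s x) && (x <= y).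
Proof.
by case: s => [|z s] /=; rewrite ?andbT // !rcons_path last_rcons.
Qed.

(** The induction replaces j by the last tuple entry, so the entries range over a type with a fixed
    bound M, and sortedness up to j does the actual bounding. *)
Lemma binsum_tuple (M k n j : nat) : j <= M ->
  binsum k.+2 n j =
  \sum_(t : k.-tuple 'I_M.+1 | sorted leq (rcons (map val t) j))
    bin_prod (0 :: map val t ++ [:: j; n]).
Proof.
elim: k n j => [|k IHk] n j le_jM.
  rewrite binsumS; under eq_bigr do rewrite binsum_1.
  rewrite (big_pred1 [tuple]) /=; last by move=> t; rewrite (tuple0 t) [RHS]eqxx.
  rewrite big_ord_recl big1 ?addn0 => [|i _]; last by rewrite !muln0.
  by rewrite /bin_prod big_ord1 /= bin0 !muln1 addn0.
rewrite binsumS [RHS]big_mkcond /=.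
pose G (t : seq 'I_M.+1) := if sorted leq (rcons (map val t) j) then
  bin_prod (0 :: map val t ++ [:: j; n]) else 0.
rewrite (@big_tuple_rcons _ k G) /G.
rewrite (big_ord_widen M.+1 (fun i => 'C(n + i, 2 * j) * binsum k.+2 j i)) //.
rewrite [LHS]big_mkcond; apply: eq_bigr => i _ /=.
case: ltnP => [le_ij|lt_ji]; last first.
  rewrite big1 // => t _; rewrite map_rcons sorted_rcons2.
  by rewrite leqNgt lt_ji andbF.
rewrite (IHk j i); last by rewrite -ltnS.
rewrite big_distrr [LHS]big_mkcond; apply: eq_bigr => t _ /=.
rewrite map_rcons sorted_rcons2 -ltnS le_ij andbT; case: ifP => // _.
have -> x y : 0 :: map val t ++ [:: x; y] = rcons (rcons (0 :: map val t) x) y.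
  by rewrite /= -!cats1 -!catA.
by rewrite -bin_prod_rcons /= -!cats1 -!catA.
Qed.

(** * Decomposition of 231-avoiding words *)

Fixpoint av231 (w : seq nat) : bool :=
  if w is x :: w' then pairwise (fun y z => ~~ (z < x < y)) w' && av231 w' else true.

(* The initial 0 is never larger than the first letter, hence adds no descent. *)
Definition descents (w : seq nat) : nat :=
  sumn (pairmap (fun x y => (y < x) : nat) 0 w).

(** The strict bound gives the recursion in K a base: at K = 0 no permutation of a nonempty set
    qualifies. *)
Fixpoint drops_lt (i K : nat) (w : seq nat) : bool :=
  if w is x :: w' then (i < x + K) && drops_lt i.+1 K w' else true.

Definition glue (n : nat) (L R : seq nat) : seq nat :=
  L ++ n :: map (addn (size L)) R.

Lemma pairwise_map_addn (x p : nat) (R : seq nat) :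
  pairwise (fun y z => ~~ (z < p + x < y)) (map (addn p) R)
    = pairwise (fun y z => ~~ (z < x < y)) R.
Proof.
by rewrite pairwise_map; apply: eq_pairwise => y z /=; rewrite !ltn_add2l.
Qed.

Lemma av231_map_addn (p : nat) (R : seq nat) : av231 (map (addn p) R) = av231 R.
Proof. by elim: R => //= x R ->; rewrite pairwise_map_addn. Qed.

(** If the 2 of a pattern lies in L, its 1 is smaller and hence in L too, and so is the 3 between
    them. The maximum n cannot be the 2, so every other pattern lies in R. *)
Lemma av231_cat (n : nat) (L R : seq nat) :
    all (gtn n) L -> all (gtn n) R -> allrel ltn L R ->
  av231 (L ++ n :: R) = av231 L && av231 R.
Proof.
move=> ltL ltR; elim: L ltL => [_ _|x L IHL /= /andP[lt_xn ltL]] /=.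
  rewrite (_ : pairwise _ R = true) //; apply/(pairwiseP 0) => a b lt_a lt_b _.
  rewrite negb_and -!leqNgt [X in _ || X]ltnW ?orbT //.
  by apply: (allP ltR); rewrite mem_nth.
rewrite allrel_consl => /andP[lt_xR lt_LR]; rewrite IHL // andbA; congr (_ && _).
rewrite pairwise_cat /= allrel_consr.
have nle z : z \in n :: R -> x < z.
  by rewrite inE => /predU1P[-> //|/(allP lt_xR)].
have -> : all (fun y => ~~ (n < x < y)) L by apply/allP => y _ /=; lia.
have -> : allrel (fun y z => ~~ (z < x < y)) L R.
  apply/allrelP => y z _ zR; have := nle z; rewrite inE zR orbT; lia.
have -> : all (fun z => ~~ (z < x < n)) R.
  by apply/allP => z zR; have := nle z; rewrite inE zR orbT; lia.
have -> : pairwise (fun y z => ~~ (z < x < y)) R.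
  apply/(pairwiseP 0) => a b _ lt_b _; have := nle (nth 0 R b).
  by rewrite inE mem_nth ?orbT //; lia.
by rewrite !andbT.
Qed.

Lemma av231_splitP (n : nat) (L R : seq nat) :
  av231 (L ++ n :: R) -> {in L & R, forall x z, ~~ (z < x < n)}.
Proof.
elim: L => //= y L IHL /andP[pw_y /IHL {}IHL] x z; rewrite inE.
case/predU1P=> [->|]; last exact: IHL.
move=> zR; move: pw_y; rewrite pairwise_cat /= => /and4P[_ _ /allP/(_ z zR) //].
Qed.

Lemma descents_map_addn (p : nat) (R : seq nat) : descents (map (addn p) R) = descents R.
Proof.
case: R => //= x R; rewrite /descents /=; congr (_ + _).
by elim: R x => //= y R IHR x; rewrite IHR ltn_add2l.
Qed.

(** No descent leads into the maximum n, and one leaves it exactly when R is nonempty. *)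
Lemma descents_cat (n : nat) (L R : seq nat) : all (gtn n) L -> all (gtn n) R ->
  descents (L ++ n :: R) = descents L + descents R + (R != [::]).
Proof.
move=> ltL ltR; rewrite /descents pairmap_cat sumn_cat /= -addnA; congr (_ + _).
have -> : (n < last 0 L) = false.
  by case/lastP: L ltL => //= L x; rewrite last_rcons all_rcons => /andP[/ltnW]; lia.
by case: R ltR => //= x R /andP[/= -> _]; rewrite !add0n addnC.
Qed.

Lemma drops_lt_cat (i K : nat) (L R : seq nat) :
  drops_lt i K (L ++ R) = drops_lt i K L && drops_lt (i + size L) K R.
Proof.
elim: L i => [|x L IHL] i /=; first by rewrite addn0.
by rewrite IHL addSnnS andbA.
Qed.

Lemma drops_lt_map_addn (p i K : nat) (R : seq nat) :
  drops_lt (p.+1 + i) K.+1 (map (addn p) R) = drops_lt i K R.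
Proof.
elim: R i => //= x R IHR i; rewrite -addnS IHR; congr (_ && _); lia.
Qed.

Lemma drops_lt_glue (n K : nat) (L R : seq nat) : size L <= n ->
  drops_lt 0 K.+1 (glue n L R) = drops_lt 0 K.+1 L && drops_lt 0 K R.
Proof.
move=> leLn; rewrite drops_lt_cat /= add0n.
have -> : size L < n + K.+1 by lia.
by rewrite -[(size L).+1]addn0 drops_lt_map_addn.
Qed.

Definition words231 (n : nat) : seq (seq nat) :=
  [seq w <- permutations (iota 0 n) | av231 w].

Lemma mem_words231 (n : nat) (w : seq nat) :
  (w \in words231 n) = av231 w && perm_eq w (iota 0 n).
Proof. by rewrite mem_filter mem_permutations. Qed.

Lemma words231_size (n : nat) (w : seq nat) : w \in words231 n -> size w = n.
Proof. by rewrite mem_words231 => /andP[_ /perm_size]; rewrite size_iota. Qed.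

Lemma words231_lt (n : nat) (w : seq nat) : w \in words231 n -> all (gtn n) w.
Proof.
rewrite mem_words231 => /andP[_ /perm_mem eq_w]; apply/allP => x.
by rewrite eq_w mem_iota.
Qed.

Lemma glue_words231 (n p : nat) (L R : seq nat) : p <= n ->
  L \in words231 p -> R \in words231 (n - p) ->
  (glue n L R \in words231 n.+1) /\ index n (glue n L R) = p.
Proof.
move=> le_pn WL WR; have szL := words231_size WL.
have ltL := words231_lt WL; have ltR := words231_lt WR.
have ltLn : all (gtn n) L by apply: sub_all ltL => x /=; lia.
split; last first.
  rewrite index_cat /= eqxx addn0 szL; case: ifP => // /(allP ltLn) /=.
  by rewrite ltnn.
move: WL WR; rewrite !mem_words231 /glue szL => /andP[avL permL] /andP[avR permR].
rewrite av231_cat ?av231_map_addn ?avL ?avR // ?andTb.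
- have -> : iota 0 n.+1 = iota 0 p ++ iota p (n - p) ++ [:: n].
    by rewrite -addn1 iotaD -{1}(subnKC le_pn) iotaD !add0n -catA.
  rewrite -cat1s; apply: perm_cat => //; rewrite perm_catC perm_cat //.
  by rewrite -[p in iota p]addn0 iotaDl perm_map.
- rewrite all_map; apply: sub_all ltR => x /=; lia.
- apply/allrelP => x _ /(allP ltL) /= ltx /mapP[y _ ->]; lia.
Qed.

Lemma words231_glue (n : nat) (w : seq nat) : w \in words231 n.+1 ->
  exists L R, [/\ index n w <= n, L \in words231 (index n w),
    R \in words231 (n - index n w) & w = glue n L R].
Proof.
rewrite mem_words231 => /andP[av_w perm_w].
have uniq_w : uniq w by rewrite (perm_uniq perm_w) iota_uniq.
have n_w : n \in w by rewrite (perm_mem perm_w) mem_iota ltnSn.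
case/splitPr: n_w av_w perm_w uniq_w => L R av_w perm_w uniq_w.
have nL : n \notin L by move: uniq_w; rewrite cat_uniq /= negb_or => /and3P[_ /andP[]].
have perm_LR : perm_eq (L ++ R) (iota 0 n).
  have perm_nLR : perm_eq (L ++ n :: R) (n :: L ++ R) by rewrite -cat1s perm_catCA.
  rewrite -(perm_cons n) -(permPl perm_nLR) (permPl perm_w) -addn1 iotaD add0n.
  by rewrite perm_catC.
(* With n as the 3, a letter of R below a letter of L would complete a 231. *)
have lt_LR : allrel ltn L R.
  apply/allrelP => x z xL zR; have := av231_splitP av_w xL zR.
  have xLR : x \in L ++ R by rewrite mem_cat xL.
  have xn : x < n by move: xLR; rewrite (perm_mem perm_LR) mem_iota.
  have neq : z != x.
    move: uniq_w; rewrite cat_uniq => /and3P[_ /hasPn/(_ z) nLz _].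
    by apply: contraNneq (nLz _) => [->|] //; rewrite inE zR orbT.
  lia.
have /andP[ltL ltR] : all (gtn n) L && all (gtn n) R.
  by rewrite -all_cat (perm_all _ perm_LR); apply/allP => x; rewrite mem_iota.
have /andP[avL avR] : av231 L && av231 R by rewrite -(av231_cat ltL ltR lt_LR).
have le_szL : size L <= n.
  by have := perm_size perm_LR; rewrite size_cat size_iota; lia.
(* Since L lies below R, sorting them separately sorts the whole; cutting [iota 0 n] at [size L]
   then identifies the letters of each. *)
have : sort leq L ++ sort leq R = iota 0 n.
  apply: (sorted_eq leq_trans anti_leq).
  - rewrite (sorted_pairwise leq_trans) pairwise_cat -!(sorted_pairwise leq_trans).
    rewrite !(sort_sorted leq_total) !andbT.
    apply/allrelP => x z; rewrite !mem_sort => xL zR; exact/ltnW/(allrelP lt_LR x z).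
  - exact: iota_sorted.
  - by rewrite (perm_trans _ perm_LR) // perm_cat ?perm_sort.
rewrite -[in iota 0 n](subnKC le_szL) iotaD add0n => /eqP.
rewrite eqseq_cat ?size_sort ?size_iota // => /andP[/eqP sortL /eqP sortR].
have permL : perm_eq L (iota 0 (size L)) by rewrite -sortL perm_sym perm_sort.
have permR : perm_eq R (iota (size L) (n - size L)).
  by rewrite -[in iota _ _]sortR perm_sym perm_sort.
rewrite index_cat (negPf nL) /= eqxx addn0.
pose R' := map (subn^~ (size L)) R.
have defR : R = map (addn (size L)) R'.
  rewrite -map_comp map_id_in // => x; rewrite (perm_mem permR) mem_iota /= => /andP[le_x _].
  exact: subnKC.
exists L, R'; split=> //; last by rewrite /glue -defR.
- by rewrite mem_words231 avL.
- rewrite mem_words231 -(av231_map_addn (size L)) -defR avR.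
  by apply: (@perm_map_inj _ _ _ (@addnI (size L))); rewrite -defR -iotaDl addn0.
Qed.

(** * Counting words by the position of the maximum *)

Lemma glue_inj (n p : nat) (L R L' R' : seq nat) : size L = p -> size L' = p ->
  glue n L R = glue n L' R' -> L = L' /\ R = R'.
Proof.
move=> szL szL' /eqP; rewrite /glue szL szL' eqseq_cat ?szL // eqseq_cons eqxx /=.
by case/andP=> /eqP -> /eqP/(inj_map (@addnI p)).
Qed.

Lemma perm_words231 (n p : nat) : p <= n ->
  perm_eq [seq w <- words231 n.+1 | index n w == p]
          [seq glue n L R | L <- words231 p, R <- words231 (n - p)].
Proof.
have uniq_words m : uniq (words231 m) by rewrite filter_uniq ?permutations_uniq.
move=> le_pn; apply: uniq_perm; first by rewrite filter_uniq.
  apply: allpairs_uniq => // -[L R] [L' R'] /allpairsP[[L1 R1] [/= L1p _ [-> ->]]].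
  move=> /allpairsP[[L2 R2] [/= L2p _ [-> ->]]] eq_g.
  by have [-> ->] := glue_inj (words231_size L1p) (words231_size L2p) eq_g.
move=> w; rewrite mem_filter; apply/andP/allpairsP => [[/eqP <-]|[[L R] [/= Lp Rp ->]]].
  by case/words231_glue => L [R [_ Lp Rp eq_w]]; exists (L, R).
by have [-> ->] := glue_words231 le_pn Lp Rp.
Qed.

Lemma count_words231 (P : pred (seq nat)) (n : nat) :
  count P (words231 n.+1)
    = \sum_(p < n.+1) \sum_(L <- words231 p)
        count (fun R => P (glue n L R)) (words231 (n - p)).
Proof.
(* The default value of [inord] never arises: the words counted contain n at an index at most n. *)
rewrite -sum1_count (partition_big (fun w => inord (index n w) : 'I_n.+1) xpredT) //=.
apply: eq_bigr => p _; have le_pn : p <= n by rewrite -ltnS.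
transitivity (\sum_(w <- [seq w <- words231 n.+1 | index n w == p] | P w) 1).
  rewrite big_filter_cond [LHS]big_seq_cond [RHS]big_seq_cond; apply: eq_bigl => w.
  case: (boolP (w \in _)) => //= /words231_glue [L [R [le_wn _ _ _]]].
  by rewrite andbC -val_eqE /= inordK.
rewrite (perm_big _ (perm_words231 le_pn)) big_mkcond big_allpairs_dep /=.
by apply: eq_bigr => L _; rewrite -big_mkcond sum1_count.
Qed.

(** A Cauchy product: each x contributes only to the term a = f x. *)
Lemma sum_count_conv (S T : Type) (f : S -> nat) (g : T -> nat) (P : pred S) (Q : pred T)
    (s : seq S) (t : seq T) (j : nat) :
  \sum_(x <- s) count (fun y => (f x + g y == j) && (P x && Q y)) t
    = \sum_(a < j.+1) count (fun x => (f x == a) && P x) s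
                      * count (fun y => (g y == j - a) && Q y) t.
Proof.
elim: s => [|x s IHs] /=; first by rewrite big_nil big1.
rewrite big_cons IHs; under [RHS]eq_bigr do rewrite mulnDl.
rewrite big_split /=; congr (_ + _).
case: (leqP (f x) j) => [le_fj|lt_jf]; last first.
  rewrite (eq_count (a2 := pred0)) ?count_pred0 => [|y /=]; last first.
    by case: eqP => // ; lia.
  by rewrite big1 // => a _; have := ltn_ord a; case: eqP => //; lia.
rewrite (bigD1 (Ordinal (le_fj : f x < j.+1))) //= [X in _ = _ + X]big1 ?addn0 => [|a].
  rewrite eqxx /=; case: (P x); last first.
    by rewrite mul0n (eq_count (a2 := pred0)) ?count_pred0 // => y; rewrite andbF.
  by rewrite mul1n; apply: eq_count => y /=; congr (_ && _); lia.
by rewrite -val_eqE /= eq_sym => /negPf ->.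
Qed.

Definition num_words231 (K n j : nat) : nat :=
  count (fun w => (descents w == j) && drops_lt 0 K w) (words231 n).

Lemma num_words231_0l (K j : nat) : num_words231 K 0 j = (j == 0).
Proof. by case: j. Qed.

Lemma drops_lt_K0 (i : nat) (w : seq nat) : drops_lt i 0 w -> all (ltn i) w.
Proof.
elim: w i => //= x w IHw i /andP[lt_ix /IHw]; rewrite addn0 in lt_ix; rewrite lt_ix /=.
by apply: sub_all => y /=; apply: ltnW.
Qed.

Lemma num_words231_K0 (n j : nat) : num_words231 0 n.+1 j = 0.
Proof.
apply/eqP; rewrite -leqn0 leqNgt -has_count; apply/hasPn => w.
rewrite mem_words231 => /andP[_ /perm_mem eq_w]; rewrite negb_and orbC.
apply/orP; left; apply/negP => /drops_lt_K0 /allP /(_ 0).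
by rewrite eq_w mem_iota => /(_ isT).
Qed.

(** The summand [p < n] is the descent after the maximum, since R has n - p letters. *)
Lemma count_glue (K n p j : nat) : p <= n ->
  \sum_(L <- words231 p)
     count (fun R => (descents (glue n L R) == j) && drops_lt 0 K.+1 (glue n L R))
           (words231 (n - p))
  = \sum_(L <- words231 p)
     count (fun R => (descents L + (descents R + (p < n)) == j)
                     && (drops_lt 0 K.+1 L && drops_lt 0 K R)) (words231 (n - p)).
Proof.
move=> le_pn; apply: eq_big_seq => L Lp; apply: eq_in_count => R Rp.
have szL := words231_size Lp; have szR := words231_size Rp.
rewrite drops_lt_glue ?szL // /glue descents_cat.
- rewrite descents_map_addn -addnA; congr ((_ + (_ + _) == _) && _).
  by rewrite -!size_eq0 size_map szR; lia.
- by apply: sub_all (words231_lt Lp) => x /=; lia.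
- by rewrite all_map; apply: sub_all (words231_lt Rp) => x /=; lia.
Qed.

(** Without descents the maximum comes last, so only p = n survives. *)
Lemma num_words231_rec0 (K n : nat) : num_words231 K.+1 n.+1 0 = num_words231 K.+1 n 0.
Proof.
rewrite /num_words231 count_words231.
have le_pn (p : 'I_n.+1) : p <= n by rewrite -ltnS.
under eq_bigr => p _ do rewrite (count_glue _ _ (le_pn p)).
rewrite big_ord_recr big1 /= => [|p _].
  rewrite subnn add0n ltnn -sum1_count [RHS]big_mkcond; apply: eq_bigr => L _ /=.
  by rewrite !addn0 andbT; case: ifP.
apply: big1 => L _; rewrite (eq_count (a2 := pred0)) ?count_pred0 // => R /=.
by rewrite ltn_ord addn1 addnS.
Qed.

(** The first term is p = n, where R is empty; for p < n the descent after the maximum leaves j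
    descents to share between L and R. *)
Lemma num_words231_rec (K n j : nat) :
  num_words231 K.+1 n.+1 j.+1 = num_words231 K.+1 n j.+1
    + \sum_(p < n) \sum_(a < j.+1) num_words231 K.+1 p a * num_words231 K (n - p) (j - a).
Proof.
rewrite {1}/num_words231 count_words231.
have le_pn (p : 'I_n.+1) : p <= n by rewrite -ltnS.
under eq_bigr => p _ do rewrite (count_glue _ _ (le_pn p)).
rewrite big_ord_recr addnC /=; congr (_ + _); last first.
  rewrite /num_words231 subnn ltnn -sum1_count [RHS]big_mkcond; apply: eq_bigr => L _ /=.
  by rewrite !addn0 andbT; case: ifP.
apply: eq_bigr => p _; rewrite -sum_count_conv; apply: eq_bigr => L _.
by apply: eq_count => R /=; rewrite ltn_ord addn1 addnS eqSS.
Qed.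

Lemma num_words231E (K n j : nat) : num_words231 K n j = binsum K n j.
Proof.
elim: K n j => [|K IHK] [|n] j; rewrite ?num_words231_0l ?binsum_0l //.
  exact: num_words231_K0.
elim/ltn_ind: n j => n IHn [|j].
  rewrite num_words231_rec0 binsumS_0r.
  by case: n IHn => [|n] IHn; rewrite ?num_words231_0l // IHn ?binsumS_0r.
have {}IHn p i : p <= n -> num_words231 K.+1 p i = binsum K.+1 p i.
  by case: p => [|p] le_pn; rewrite ?num_words231_0l ?binsum_0l // IHn.
(* The added term matches p = n in the convolution of [binsum_rec], which the recurrence for words
   lacks. *)
apply: (@addIn (binsum K.+1 n j)); rewrite binsum_rec num_words231_rec IHn // -addnA.
congr (_ + _).
rewrite [RHS]exchange_big big_ord_recr /=; congr (_ + _).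
  by apply: eq_bigr => p _; apply: eq_bigr => a _; rewrite IHn ?IHK // ltnW.
rewrite big_ord_recr big1 /= => [|a _]; rewrite subnn binsum_0l.
  by rewrite subnn muln1.
by rewrite subn_eq0 leqNgt ltn_ord muln0.
Qed.

(** * Permutations as words *)

Definition perm_word (n : nat) (s : 'S_n) : seq nat := [seq val (s i) | i <- enum 'I_n].

Lemma size_perm_word (n : nat) (s : 'S_n) : size (perm_word s) = n.
Proof. by rewrite size_map size_enum_ord. Qed.

Lemma nth_perm_word (n : nat) (s : 'S_n) (i : 'I_n) : nth 0 (perm_word s) i = s i.
Proof. by rewrite (nth_map i) ?size_enum_ord // nth_ord_enum. Qed.

Lemma perm_word_inj (n : nat) : injective (@perm_word n).
Proof.
move=> s t eq_st; apply/permP => i; apply: val_inj.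
by rewrite /= -!nth_perm_word eq_st.
Qed.

(** Distinct permutations give distinct words, and n! of them exhaust the n! arrangements of
    [iota 0 n]. *)
Lemma perm_word_permutations (n : nat) :
  perm_eq [seq perm_word s | s <- enum 'S_n] (permutations (iota 0 n)).
Proof.
have uniq_l : uniq [seq perm_word s | s <- enum 'S_n].
  by rewrite map_inj_uniq ?enum_uniq //; apply: perm_word_inj.
apply: uniq_perm => //; first exact: permutations_uniq.
apply: (uniq_min_size _ _ _).2 => //.
  move=> _ /mapP[s _ ->]; rewrite mem_permutations.
  rewrite -val_enum_ord /perm_word (map_comp val s); apply: perm_map.
  apply: uniq_perm; rewrite ?(map_inj_uniq (@perm_inj _ s)) ?enum_uniq //.
  by move=> i; rewrite mem_enum -(permKV s i) map_f ?mem_enum.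
rewrite size_permutations ?iota_uniq // size_iota size_map -cardE.
by rewrite card_Sn.
Qed.

Lemma av231P (w : seq nat) :
  reflect (forall a b c, a < b < c -> c < size w ->
             ~~ (nth 0 w c < nth 0 w a < nth 0 w b)) (av231 w).
Proof.
elim: w => [|x w IHw] /=; first by left.
apply: (iffP andP) => [[/(pairwiseP 0) pw /IHw av] a b c /andP[lt_ab lt_bc] lt_c|av].
  case: b lt_ab lt_bc => // b lt_ab; case: c lt_c => // c lt_c lt_bc.
  case: a lt_ab => [_|a lt_ab] /=; last by apply: av => //; apply/andP.
  by apply: pw; rewrite ?inE //; lia.
split; last by apply/IHw => a b c lt_abc lt_c; apply: (av a.+1 b.+1 c.+1).
apply/(pairwiseP 0) => b c lt_b lt_c lt_bc; apply: (av 0 b.+1 c.+1) => //.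
Qed.

Lemma av231_perm_word (n : nat) (s : 'S_n) : av231 (perm_word s) = avoids231 s.
Proof.
apply/av231P/forallP => [av a|av a b c lt_abc].
  apply/forallP => b; apply/forallP => c; apply/implyP => lt_abc.
  by rewrite -!nth_perm_word av // size_perm_word.
rewrite size_perm_word => lt_c; have lt_b : b < n by lia.
have lt_a : a < n by lia.
have /forallP/(_ (Ordinal lt_b))/forallP/(_ (Ordinal lt_c))/implyP/(_ lt_abc) :=
  av (Ordinal lt_a).
by rewrite -!nth_perm_word.
Qed.

Lemma descents_perm_word (n : nat) (s : 'S_n) : descents (perm_word s) = des s.
Proof.
rewrite /descents sumnE (big_nth 0) size_pairmap size_perm_word big_mkord.
under eq_bigr => i _ do rewrite (nth_pairmap 0) ?size_perm_word //.
rewrite /des -sum1_card [RHS]big_mkcond /=.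
case: n s => [|n] s; first by rewrite !big_ord0.
(* [descents] records a descent at its second position and [des] at its first: the initial position
   on the left and the last one on the right contribute nothing, and the others match after a shift
   by one. *)
rewrite big_ord_recl [RHS]big_ord_recr /= [X in _ = _ + X]ifF ?addn0 ?add0n; last first.
  by apply/negbTE; rewrite inE; apply/existsPn => i'; rewrite ltn_eqF.
apply: eq_bigr => i _; rewrite inE add0n.
rewrite (nth_perm_word s (lift ord0 i)) (nth_perm_word s (widen_ord (leqnSn n) i)).
case: existsP => [[i' /andP[/eqP eq_i' lt_s]]|no_i'].
  by rewrite (_ : lift ord0 i = i') ?lt_s //; apply: val_inj; exact: esym.
by case: ltnP => // lt_s; case: no_i'; exists (lift ord0 i); rewrite lt_s eqxx.
Qed.

Lemma drops_ltP (i K : nat) (w : seq nat) :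
  reflect (forall m, m < size w -> i + m < nth 0 w m + K) (drops_lt i K w).
Proof.
elim: w i => [|x w IHw] i /=; first by left.
apply: (iffP andP) => [[lt_i /IHw lt_w] [|m] //= lt_m|lt_w].
- by rewrite addn0.
- by rewrite -addSnnS; apply: lt_w.
split; first by have := lt_w 0 isT; rewrite addn0.
by apply/IHw => m lt_m; rewrite addSnnS; apply: (lt_w m.+1).
Qed.

Lemma drops_lt_perm_word (k n : nat) (s : 'S_n) :
  drops_lt 0 k.+1 (perm_word s) = (maxdrop s <= k).
Proof.
apply/drops_ltP/bigmax_leqP => [lt_s i _|le_s m].
  by have := lt_s i; rewrite size_perm_word nth_perm_word add0n addnS ltnS leq_subLR; apply.
rewrite size_perm_word => lt_m; have := le_s (Ordinal lt_m) isT.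
by rewrite -nth_perm_word add0n addnS ltnS leq_subLR.
Qed.

Lemma a231E (k n j : nat) : a231 k n j = num_words231 k.+1 n j.
Proof.
rewrite /num_words231 count_filter -(seq.permP (perm_word_permutations n)) count_map.
rewrite /a231 cardE size_filter -enumT; apply: eq_count => s.
rewrite /= inE av231_perm_word descents_perm_word drops_lt_perm_word.
exact: andbC.
Qed.

Theorem theorem20 (n j k : nat) (hk : 2 <= k) :
  a231 k n j =
  \sum_(t : (k.-1).-tuple 'I_j.+1 | sorted leq [seq val i | i <- t])
    \prod_(m < k)
      'C(ext_index n t m.+2 + ext_index n t m, 2 * ext_index n t m.+1).
Proof.
rewrite a231E num_words231E.
case: k hk => [|k] // _; rewrite (@binsum_tuple j) //.
apply: eq_big => [t|t _].
  (* The final comparison with j holds automatically, as entries lie in ['I_j.+1]. *)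
  case: t => t /= _; case/lastP: t => // t x.
  by rewrite map_rcons sorted_rcons2 -ltnS ltn_ord andbT.
by rewrite /bin_prod /= size_cat size_map size_tuple addn2 !subSS subn0.
Qed.
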